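(* Let $n\geq 4$ be an integer, and regard $\tilde{J}(n,2)$ as a subset of the $(n-1)$-dimensional Euclidean space $H_{n,2}=\{(x_1,\dots,x_n)\in\mathbb{R}^n:\sum_i x_i=2\}\simeq\mathbb{R}^{n-1}$. If $n\neq 9$, then $\tilde{J}(n,2)$ is maximal as a two-distance set in $H_{n,2}$. If $n=9$, then the maximal two-distance set in $H_{9,2}$ which contains $\tilde{J}(9,2)$ is (uniquely) $$\left(1^2,0^7\right)^P\ \cup\ \left(\left(\tfrac13\right)^8,\,-\tfrac23\right)^P,$$ which has $45$ vectors.
   Context: Notation: $(a_1^{r_1},\dots,a_t^{r_t})^P$ denotes the set of all vectors obtained by permuting the coordinates of the vector in which $a_i$ occurs $r_i$ times; inside the parentheses exponents are multiplicities, not powers. $\tilde{J}(n,2)=(1^2,0^{n-2})^P\subset\mathbb{R}^n$ is the set of all $0/1$ vectors of length $n$ with exactly two ones (the representation of the Johnson graph $J(n,2)$). A finite subset of a Euclidean space is an $s$-distance set if exactly $s$ distinct values occur as Euclidean distances between distinct points of it. An $s$-distance set is maximal in a given space if no other $s$-distance set in that space contains it. *)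

(* Defs.v *)
From HB Require Import structures.
From mathcomp Require Import all_boot all_order all_algebra all_fingroup finmap.
From mathcomp Require Import reals.
Set Implicit Arguments.
Unset Strict Implicit.
Unset Printing Implicit Defensive.
Import Order.TTheory GRing.Theory Num.Theory.
Local Open Scope ring_scope.
Local Open Scope fset_scope.

(* The norm that MathComp-Analysis puts on 'rV[R]_n is the sup norm, so the
   Euclidean distance has to be written out. *)
Definition edist (R : realType) (n : nat) (x y : 'rV[R]_n) : R :=
  Num.sqrt (\sum_(i < n) (x 0 i - y 0 i) ^+ 2).

Definition distances (R : realType) (n : nat) (A : {fset 'rV[R]_n}) : {fset R} :=
  [fset edist x y | x in A, y in A & x != y].

Definition distance_set (R : realType) (n s : nat) (A : {fset 'rV[R]_n}) : Prop :=
  #|` distances A| = s.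

Definition maximal_distance_set (R : realType) (n s : nat)
    (X : {pred 'rV[R]_n}) (A : {fset 'rV[R]_n}) : Prop :=
  [/\ {subset A <= X},
      distance_set s A
    & forall B : {fset 'rV[R]_n},
        {subset B <= X} -> distance_set s B -> A `<=` B -> B = A].

Definition hyperplane (R : realType) (n k : nat) : {pred 'rV[R]_n} :=
  [pred x : 'rV[R]_n | \sum_(i < n) x 0 i == k%:R].
Arguments hyperplane : clear implicits.

(* [:: (a_1, r_1); ...; (a_t, r_t)] encodes the vector of length
   r_1 + ... + r_t in which a_i occurs r_i times; the length is meant to be n
   (missing coordinates would be filled with 0, extra ones dropped). *)
Definition mult_vec (R : realType) (n : nat) (m : seq (R * nat)) : 'rV[R]_n :=
  \row_(i < n) nth 0 (flatten [seq nseq p.2 p.1 | p <- m]) i.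
Arguments mult_vec {R} n m.

Definition perm_vecs (R : realType) (n : nat) (m : seq (R * nat)) :
    {fset 'rV[R]_n} :=
  [fset col_perm s (mult_vec n m) | s in 'S_n].
Arguments perm_vecs {R} n m.

Definition johnson2 (R : realType) (n : nat) : {fset 'rV[R]_n} :=
  perm_vecs n [:: (1, 2%N); (0, (n - 2)%N)].

(* Main.v *)
(** The points of [johnson2] are the indicator vectors of the pairs, and they
    realise the distances [sqrt 2] and [2], so a two-distance set containing
    them has no other distance.  Write [S] for the squared norm of an added
    point [x].  Its squared distance to the indicator of [{i, j}] is
    [S - 2 (x_i + x_j) + 2], hence each sum [x_i + x_j] is [S/2] or [S/2 - 1].
    This forces all the coordinates of [x] but at most one to be equal, the
    exceptional one differing from the others by 1.  Together with
    [sum_i x_i = 2], the only solution is [n = 9] with the vectors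
    [((1/3)^8, -2/3)^P]. *)
Require Import Defs.
From HB Require Import structures.
From mathcomp Require Import all_boot all_order all_algebra all_fingroup finmap.
From mathcomp Require Import reals.
From mathcomp Require Import ring lra zify.
Set Implicit Arguments.
Unset Strict Implicit.
Unset Printing Implicit Defensive.
Import Order.TTheory GRing.Theory Num.Theory.
Local Open Scope fset_scope.
Local Open Scope ring_scope.

(** * Squared distances and indicator vectors *)

Definition sqdist (R : realType) (n : nat) (x y : 'rV[R]_n) : R :=
  \sum_(i < n) (x 0 i - y 0 i) ^+ 2.

Definition sqnorm (R : realType) (n : nat) (x : 'rV[R]_n) : R :=
  \sum_(i < n) x 0 i ^+ 2.

Definition indic (R : realType) (n : nat) (A : {set 'I_n}) : 'rV[R]_n :=
  \row_i (i \in A)%:R.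
Arguments indic R {n} A.

(** These are the extra points of the case [n = 9], with [-2/3] in position [i]. The length stays
    general because [outside_point_thirds] obtains [n = 9] together with the shape of the point. *)
Definition thirds (R : realType) (n : nat) (i : 'I_n) : 'rV[R]_n :=
  \row_k (3%:R^-1 - (k == i)%:R).
Arguments thirds R {n} i.

Section Vectors.
Variables (R : realType) (n : nat).
Implicit Types (x y : 'rV[R]_n) (A B : {set 'I_n}).

Lemma sqdist_ge0 x y : 0 <= sqdist x y.
Proof. by apply: sumr_ge0 => i _; rewrite sqr_ge0. Qed.

Lemma sqdistC x y : sqdist x y = sqdist y x.
Proof. by apply: eq_bigr => i _; rewrite -sqrrN opprB. Qed.

Lemma sum_indic A : \sum_i indic R A 0 i = #|A|%:R.
Proof.
rewrite -sum1_card natr_sum [RHS]big_mkcond /=.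
by apply: eq_bigr => i _; rewrite mxE; case: (i \in A).
Qed.

Lemma sqnorm_indic A : sqnorm (indic R A) = #|A|%:R.
Proof.
rewrite -sum_indic; apply: eq_bigr => i _.
by rewrite mxE; case: (i \in A); rewrite ?expr1n ?expr0n.
Qed.

Lemma sqdist_indic x A :
  sqdist x (indic R A) = sqnorm x - 2%:R * (\sum_(i in A) x 0 i) + #|A|%:R.
Proof.
rewrite -sqnorm_indic /sqnorm mulr_sumr [X in _ - X + _]big_mkcond /=.
rewrite -sumrB -big_split /=; apply: eq_bigr => i _.
by rewrite mxE; case: (i \in A) => /=; ring.
Qed.

Lemma sqdist_indic2 A B :
  sqdist (indic R A) (indic R B) = #|A|%:R - 2%:R * #|A :&: B|%:R + #|B|%:R.
Proof.
rewrite sqdist_indic sqnorm_indic; congr (_ - _ * _ + _).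
rewrite -sum_indic big_mkcond /=; apply: eq_bigr => i _.
by rewrite !mxE inE andbC; case: (i \in B).
Qed.

Lemma indic_inj : injective (indic R (n := n)).
Proof.
move=> A B AB; apply/setP => i; have /rowP/(_ i) := AB.
by rewrite !mxE => /eqP; rewrite eqr_nat; case: (i \in A); case: (i \in B).
Qed.

Lemma thirds_inj : injective (thirds R (n := n)).
Proof.
move=> i j /rowP/(_ i); rewrite !mxE eqxx => /addrI/oppr_inj/eqP.
by case: (eqVneq i j) => // _; rewrite oner_eq0.
Qed.

End Vectors.

(** * Orbits under permutations of the coordinates *)

Lemma mult_vec_two (R : realType) (n : nat) :
  (2 <= n)%N ->
  forall i : 'I_n, mult_vec n [:: (1, 2%N); (0, (n - 2)%N)] 0 i = (i < 2)%:R :> R.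
Proof.
move=> hn i; rewrite mxE /= cats0.
case: i => [[|[|k]]] //= _.
by rewrite nth_nseq if_same.
Qed.

Lemma johnson2P (R : realType) (n : nat) (x : 'rV[R]_n) : (2 <= n)%N ->
  reflect (exists2 A : {set 'I_n}, #|A| = 2%N & x = indic R A)
          (x \in johnson2 R n).
Proof.
move=> hn; have h0 : (0 < n)%N by apply: leq_trans hn.
pose o0 := Ordinal h0; pose o1 := Ordinal hn.
apply: (iffP (imfsetP _ _ _ _)) => [[s _ ->]|[A /eqP/cards2P[i [j [ij ->]]] ->]].
  exists [set i | (s i < 2)%N]; last first.
    by apply/rowP => i; rewrite /col_perm mxE (mult_vec_two R hn) mxE inE.
  rewrite (_ : finset _ = s @^-1: [set o0; o1]); last first.
    by apply/setP => i; rewrite !inE -!val_eqE /=; case: (nat_of_ord (s i)) => [|[|]].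
  rewrite -(card_imset _ (@perm_inj _ s)) (_ : _ @: _ = [set o0; o1]) ?cards2 //.
  apply/setP => k; apply/imsetP/idP => [[l + ->]|hk]; first by rewrite inE.
  by exists ((s^-1)%g k); rewrite ?inE ?permKV // -in_set2.
(* The first transposition sends [i] to [o0]. The second sends the image of [j] to [o1] and keeps
   [o0] fixed, because that image differs from [o0]. *)
pose s := (tperm i o0 * tperm (tperm i o0 j) o1)%g.
have si : s i = o0.
  rewrite permM tpermL tpermD //.
  by rewrite -{2}(tpermL i o0) (inj_eq perm_inj) eq_sym.
have sj : s j = o1 by rewrite permM tpermL.
exists s => //; apply/rowP => k; rewrite mxE [in RHS]mxE (mult_vec_two R hn).
rewrite !inE -(inj_eq (@perm_inj _ s) k i) -(inj_eq (@perm_inj _ s) k j) si sj.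
by rewrite -!val_eqE /=; case: (nat_of_ord (s k)) => [|[|]].
Qed.

Lemma card_johnson2 (R : realType) (n : nat) : (2 <= n)%N -> #|` johnson2 R n| = 'C(n, 2).
Proof.
move=> hn.
have -> : johnson2 R n =
    [fset indic R A | A in [set A : {set 'I_n} | #|A| == 2%N]].
  apply/fsetP => x; apply/johnson2P/imfsetP => // -[A].
    by move=> A2 ->; exists A; rewrite //= inE A2.
  by rewrite /= inE => /eqP A2 ->; exists A.
rewrite card_imfset /=; last exact: indic_inj.
by rewrite -cardE card_draws card_ord.
Qed.

Lemma perm_vecs_thirdsP (R : realType) (x : 'rV[R]_9) :
  reflect (exists i, x = thirds R i)
    (x \in perm_vecs 9 [:: (1 / 3%:R, 8%N); (- (2%:R / 3%:R), 1%N)]).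
Proof.
have vE (i : 'I_9) : mult_vec 9 [:: (1 / 3%:R, 8%N); (- (2%:R / 3%:R), 1%N)] 0 i
    = thirds R ord_max 0 i.
  rewrite !mxE -val_eqE /=.
  case: i; do 8 (case=> [|]; first by move=> _ /=; rewrite subr0 mul1r).
  by case=> [|//] _ /=; lra.
apply: (iffP (imfsetP _ _ _ _)) => [[s _ ->]|[i ->]].
  (* [col_perm s] reads its entry [k] at [s k], so the last entry [-2/3] lands at the preimage of
     [ord_max]. *)
  exists ((s^-1)%g ord_max); apply/rowP => k.
  by rewrite mxE vE !mxE -{2}(permK s k) (inj_eq perm_inj).
exists (tperm i ord_max) => //; apply/rowP => k.
by rewrite [RHS]mxE vE !mxE -{2}(tpermL i ord_max) (inj_eq perm_inj).
Qed.

(** * Classification of the points that can be added *)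

(** If [f j < f i], then for every other [k] the sum [f i + f k] must be the larger value and
    [f j + f k] the smaller one. So [f i - f j = 1], and [f] has a common value [q] off [i] and [j].
    Since [4 <= n], two such indices exist; their sum [q + q] decides which of [i] and [j] is
    exceptional. *)
Lemma pair_sums_two_values (R : realType) (n : nat) (f : 'I_n -> R) (a : R) :
  (4 <= n)%N ->
  (forall i j, i != j -> f i + f j = a \/ f i + f j = a - 1) ->
  exists i q,
    [\/ (forall k, f k = q) /\ (q + q = a \/ q + q = a - 1),
        (forall k, f k = q + (k == i)%:R) /\ q + q = a - 1
      | (forall k, f k = q - (k == i)%:R) /\ q + q = a].
Proof.
move=> hn H.
have fresh (s : seq 'I_n) : (size s <= 3)%N -> exists k, k \notin s.
  move=> hs; apply/existsP; rewrite -negb_forall; apply/negP => /forallP hall.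
  have : (#|'I_n| <= size s)%N.
    by apply: leq_trans (card_size s); apply/subset_leq_card/subsetP => k _.
  by rewrite card_ord; move: hn hs; lia.
have [/existsP[i /existsP[j fij]]|/existsPn cst] :=
  boolP [exists i, exists j, f j < f i]; last first.
  have [i _] := fresh [::] isT.
  have fE k : f k = f i.
    apply/eqP; rewrite eq_le !leNgt.
    by move: (cst i) (cst k) => /existsPn/(_ k) -> /existsPn/(_ i) ->.
  have [j] := fresh [:: i] isT; rewrite inE => ji.
  exists i, (f i); constructor 1; split=> //.
  by have := H _ _ ji; rewrite fE.
have neij : i != j by apply: contraTneq fij => ->; rewrite ltxx.
have rest k : k != i -> k != j -> f i + f k = a /\ f j + f k = a - 1.
  move=> ki kj; have [] := (H _ _ ki, H _ _ kj).
  by case=> ?; case=> ?; split; lra.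
have [k] := fresh [:: i; j] isT; rewrite !inE negb_or => /andP[ki kj].
have [l] := fresh [:: i; j; k] isT.
rewrite !inE !negb_or => /and3P[li lj lk].
have [ik jk] := rest k ki kj; have [il jl] := rest l li lj.
case: (H _ _ lk) => hkl.
  exists j, (f k); constructor 3; split; last by lra.
  move=> m; case: (eqVneq m j) => [->|mj] /=; first by lra.
  case: (eqVneq m i) => [->|mi]; first by lra.
  by have [] := rest m mi mj; lra.
exists i, (f k); constructor 2; split; last by lra.
move=> m; case: (eqVneq m i) => [->|mi] /=; first by lra.
case: (eqVneq m j) => [->|mj]; first by lra.
by have [] := rest m mi mj; lra.
Qed.

Lemma sum_perturbed (R : realType) (n : nat) (i : 'I_n) (q e : R) :
  \sum_(k < n) (q + e * (k == i)%:R) = n%:R * q + e.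
Proof.
rewrite big_split /= sumr_const card_ord mulr_natl; congr (_ + _).
rewrite (bigD1 i) //= eqxx mulr1 big1 ?addr0 // => k /negbTE ->.
by rewrite mulr0.
Qed.

Lemma sum_sqr_perturbed (R : realType) (n : nat) (i : 'I_n) (q e : R) :
  \sum_(k < n) (q + e * (k == i)%:R) ^+ 2
    = n%:R * q ^+ 2 + (2%:R * q * e + e ^+ 2).
Proof.
rewrite -(sum_perturbed i (q ^+ 2)); apply: eq_bigr => k _.
by case: (k == i) => /=; ring.
Qed.

Lemma outside_point_thirds (R : realType) (n : nat) (x : 'rV[R]_n) :
  (4 <= n)%N -> x \in hyperplane R n 2 ->
  (forall A : {set 'I_n}, #|A| = 2%N ->
     sqdist x (indic R A) = 2%:R \/ sqdist x (indic R A) = 4%:R) ->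
  n = 9%N /\ exists i, x = thirds R i.
Proof.
move=> hn; rewrite inE => /eqP sumx H.
have n0 : 4 <= n%:R :> R by rewrite (ler_nat R 4).
have [i [q cases]] :
    exists i q,
    [\/ (forall k, x 0 k = q) /\
          (q + q = sqnorm x / 2%:R \/ q + q = sqnorm x / 2%:R - 1),
        (forall k, x 0 k = q + (k == i)%:R) /\ q + q = sqnorm x / 2%:R - 1
      | (forall k, x 0 k = q - (k == i)%:R) /\ q + q = sqnorm x / 2%:R].
  apply: pair_sums_two_values => // i j ij.
  have := H [set i; j]; rewrite sqdist_indic cards2 ij big_setU1 ?inE //=.
  by rewrite big_set1 => /(_ erefl) []; [left|right]; lra.
(* The three shapes become one family with [e] in [{0, 1, -1}], so that the sum and the norm are
   computed only once. *)
have [e [xE qE]] : exists e, (forall k, x 0 k = q + e * (k == i)%:R) /\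
    [\/ e = 0 /\ (q + q = sqnorm x / 2%:R \/ q + q = sqnorm x / 2%:R - 1),
        e = 1 /\ q + q = sqnorm x / 2%:R - 1
      | e = -1 /\ q + q = sqnorm x / 2%:R].
  case: cases => [[xE ?]|[xE ?]|[xE ?]]; [exists 0|exists 1|exists (-1)].
  - by split; [move=> k; rewrite mul0r addr0|constructor 1].
  - by split; [move=> k; rewrite mul1r|constructor 2].
  - by split; [move=> k; rewrite mulN1r|constructor 3].
have sumE : n%:R * q + e = 2%:R.
  by rewrite -(sum_perturbed i) -sumx; apply: eq_bigr => k _; rewrite xE.
have SE : sqnorm x = q * (2%:R - e) + (2%:R * q * e + e ^+ 2).
  (* Trading [n * q] for [2 - e] makes the squared norm linear in [q] once [e] is known, which
     brings the equations within reach of [lra]. *)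
  have -> : q * (2%:R - e) = n%:R * q ^+ 2 by rewrite -sumE; ring.
  by rewrite -(sum_sqr_perturbed i); apply: eq_bigr => k _; rewrite xE.
move: qE; rewrite {}SE.
(* The four cases give [q = 0], [q = -1], [q = -1] and [q = 1/3]. In [n * q + e = 2] the first three
   contradict [4 <= n], and the last yields [n = 9]. *)
case=> [[e0 [qE|qE]]|[e1 qE]|[eN1 qE]]; subst e.
- exfalso; have q0 : q = 0 by lra.
  by rewrite q0 mulr0 in sumE; lra.
- exfalso; have q1 : q = -1 by lra.
  by rewrite q1 in sumE; lra.
- exfalso; have q1 : q = -1 by lra.
  by rewrite q1 in sumE; lra.
have q3 : q = 3%:R^-1 by lra.
have n9 : n%:R = 9%:R :> R by rewrite q3 in sumE; lra.
split; first by apply/eqP; rewrite -(eqr_nat R) n9.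
by exists i; apply/rowP => k; rewrite xE q3 mxE mulN1r.
Qed.

(** * Two-distance sets containing the Johnson points *)

Section TwoDistance.
Variables (R : realType) (n : nat).
Hypothesis hn : (4 <= n)%N.
Implicit Types A B : {fset 'rV[R]_n}.

Let hn2 : (2 <= n)%N. Proof. exact: leq_trans hn. Qed.

(** Keeping [2] as the root of 4 lets [eqr_sqrt] compare distances through their squares. *)
Let D : {fset R} := [fset Num.sqrt 2%:R; Num.sqrt 4%:R].

Let cardD : #|` D| = 2%N.
Proof. by rewrite cardfs2 eqr_sqrt ?ler0n // eqr_nat. Qed.

Lemma distancesP A (d : R) :
  reflect (exists x y, [/\ x \in A, y \in A, x != y & d = edist x y])
          (d \in distances A).
Proof.
apply: (iffP (imfset2P _ _ _ _ _)) => /=.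
  move=> [x xA [y]]; rewrite !inE => /andP[yA xy] ->.
  by exists x, y.
move=> [x [y [xA yA xy ->]]]; exists x => //; exists y => //.
by rewrite !inE yA xy.
Qed.

Lemma distances_johnson2 A : johnson2 R n `<=` A -> D `<=` distances A.
Proof.
move=> /fsubsetP JA.
have dist (P Q : {set 'I_n}) c : #|P| = 2%N -> #|Q| = 2%N ->
    #|P :&: Q| = c -> (c < 2)%N -> Num.sqrt (4%:R - 2%:R * c%:R) \in distances A.
  move=> P2 Q2 PQ c2; apply/distancesP; exists (indic R P), (indic R Q); split.
  - by apply/JA/johnson2P => //; exists P.
  - by apply/JA/johnson2P => //; exists Q.
  - by apply: contraTneq c2 => /indic_inj E; rewrite -PQ E setIid Q2.
  - by rewrite /edist -/(sqdist _ _) sqdist_indic2 P2 Q2 PQ; congr Num.sqrt; ring.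
(* Pairs among the first four indices suffice: two that share one index are at squared distance 2,
   two disjoint ones at 4. *)
pose o k (hk : (k < 4)%N) : 'I_n := Ordinal (leq_trans hk hn).
pose o0 := o 0 isT; pose o1 := o 1%N isT.
pose o2 := o 2%N isT; pose o3 := o 3%N isT.
apply/fsubsetP => d; rewrite !inE => /orP[] /eqP ->.
  have -> : 2%:R = 4%:R - 2%:R * 1%:R :> R by ring.
  apply: (dist [set o0; o1] [set o1; o2]); rewrite ?cards2 //.
  rewrite (_ : _ :&: _ = [set o1]) ?cards1 //.
  by apply/setP => z; rewrite !inE -!val_eqE /=; case: (val z) => [|[|[|]]].
have -> : 4%:R = 4%:R - 2%:R * 0%:R :> R by ring.
apply: (dist [set o0; o1] [set o2; o3]); rewrite ?cards2 //.
rewrite (_ : _ :&: _ = finset.set0) ?cards0 //.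
by apply/setP => z; rewrite !inE -!val_eqE /=; case: (val z) => [|[|[|]]].
Qed.

(** Both elements of [D] already occur by [distances_johnson2], so having exactly two distances
    means [distances A = D]. Later arguments thus avoid cardinalities and square roots. *)
Lemma distance_set2P A : johnson2 R n `<=` A ->
  distance_set 2 A <->
  {in A &, forall x y, x != y -> sqdist x y = 2%:R \/ sqdist x y = 4%:R}.
Proof.
move=> /distances_johnson2 DA; split=> [card2 x y xA yA xy|H].
  have DE : D = distances A by apply/eqP; rewrite eqEfcard DA cardD card2.
  have : edist x y \in D by rewrite DE; apply/distancesP; exists x, y.
  rewrite !inE !eqr_sqrt ?ler0n ?sqdist_ge0 //.
  by case/orP=> /eqP ?; [left|right].
rewrite /distance_set (_ : distances A = D) //.
apply/eqP; rewrite eqEfsubset DA andbT; apply/fsubsetP => d.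
case/distancesP=> x [y [xA yA xy ->]]; rewrite /edist -/(sqdist x y) !inE.
by case: (H _ _ xA yA xy) => ->; rewrite eqxx ?orbT.
Qed.

Lemma johnson2_hyperplane : {subset johnson2 R n <= hyperplane R n 2}.
Proof. by move=> x /johnson2P[//|A A2 ->]; rewrite inE sum_indic A2. Qed.

Lemma johnson2_sqdist :
  {in johnson2 R n &, forall x y, x != y -> sqdist x y = 2%:R \/ sqdist x y = 4%:R}.
Proof.
move=> _ _ /johnson2P[//|A A2 ->] /johnson2P[//|B B2 ->] AB.
rewrite sqdist_indic2 A2 B2.
(* Distinct pairs of equal size cannot contain one another, so their intersection is proper. *)
have : (#|A :&: B| < 2)%N.
  rewrite -A2; apply/proper_card; rewrite properE subsetIl /= subsetI subxx /=.
  apply: contra AB => AB; apply/eqP; congr indic; apply/eqP.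
  by rewrite eqEcard AB A2 B2.
by case: #|A :&: B| => [|[|]] // _; [right|left]; rewrite -natrM; lra.
Qed.

Lemma two_distance_extension B x :
  {subset B <= hyperplane R n 2} -> distance_set 2 B -> johnson2 R n `<=` B ->
  x \in B -> x \notin johnson2 R n -> n = 9%N /\ exists i, x = thirds R i.
Proof.
move=> BH B2 JB xB xJ; apply: outside_point_thirds => // [|A A2]; first exact: BH.
have AJ : indic R A \in johnson2 R n by apply/johnson2P => //; exists A.
move/(distance_set2P JB): B2; apply=> //; first exact: (fsubsetP JB).
by apply: contraNneq xJ => ->.
Qed.

Lemma johnson2_maximal : n <> 9%N ->
  maximal_distance_set 2 (hyperplane R n 2) (johnson2 R n).
Proof.
move=> n9; split.
- exact: johnson2_hyperplane.
- by apply/distance_set2P => //; apply: johnson2_sqdist.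
move=> B BH B2 JB; apply/eqP; rewrite eqEfsubset JB andbT.
apply/fsubsetP => x xB; apply/negPn/negP => xJ.
by have [] := two_distance_extension BH B2 JB xB xJ.
Qed.

End TwoDistance.

(** * The exceptional dimension [n = 9] *)

Lemma sum_thirds (R : realType) (i : 'I_9) : \sum_k thirds R i 0 k = 2%:R.
Proof.
rewrite (eq_bigr (fun k => 3%:R^-1 + -1 * (k == i)%:R)) => [|k _].
  by rewrite sum_perturbed; lra.
by rewrite mxE mulN1r.
Qed.

(** The squared norm is [4/3], and the entries over [A] sum to [2/3] if [A] avoids [i] and to [-1/3]
    otherwise; these give 2 and 4 respectively. *)
Lemma sqdist_thirds_indic (R : realType) (i : 'I_9) (A : {set 'I_9}) :
  #|A| = 2%N ->
  sqdist (thirds R i) (indic R A) = 2%:R \/ sqdist (thirds R i) (indic R A) = 4%:R.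
Proof.
move=> A2; rewrite sqdist_indic A2.
have -> : sqnorm (thirds R i) = 4%:R / 3%:R.
  rewrite /sqnorm (eq_bigr (fun k => (3%:R^-1 + -1 * (k == i)%:R) ^+ 2)) => [|k _].
    by rewrite sum_sqr_perturbed; lra.
  by rewrite mxE mulN1r.
move/eqP: A2 => /cards2P[j [k [jk ->]]].
rewrite big_setU1 ?inE // big_set1 !mxE.
case: (eqVneq j i) => [ji|_]; case: (eqVneq k i) => [ki|_] /=.
- by rewrite ji ki eqxx in jk.
- by right; lra.
- by right; lra.
- by left; lra.
Qed.

Lemma sqdist_thirds (R : realType) (n : nat) (i j : 'I_n) : i != j ->
  sqdist (thirds R i) (thirds R j) = 2%:R.
Proof.
move=> ij.
(* The constant [1/3] cancels, leaving the distance between two unit vectors. *)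
have -> : sqdist (thirds R i) (thirds R j)
        = sqdist (indic R [set i]) (indic R [set j]).
  by apply: eq_bigr => k _; rewrite !mxE !inE; ring.
rewrite sqdist_indic2 !cards1 (_ : _ :&: _ = finset.set0) ?cards0; first by lra.
by apply/setP => k; rewrite !inE; case: eqP => // ->; apply/negbTE.
Qed.

Section Nine.
Variable R : realType.

Let T : {fset 'rV[R]_9} :=
  perm_vecs 9 [:: (1 / 3%:R, 8%N); (- (2%:R / 3%:R), 1%N)].
Let L := johnson2 R 9 `|` T.

Lemma johnson2_thirds_hyperplane : {subset L <= hyperplane R 9 2}.
Proof.
move=> x; rewrite inE => /orP[/johnson2_hyperplane->//|/perm_vecs_thirdsP[i ->]].
by rewrite inE sum_thirds.
Qed.

Lemma johnson2_thirds_distance_set : distance_set 2 L.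
Proof.
apply/distance_set2P => //; first exact: fsubsetUl.
move=> x y; rewrite !inE => /orP[xJ|/perm_vecs_thirdsP[i ->]].
  case/orP=> [yJ|/perm_vecs_thirdsP[j ->]]; first exact: johnson2_sqdist.
  case/johnson2P: xJ => // A A2 -> _; rewrite sqdistC.
  exact: sqdist_thirds_indic.
case/orP=> [/johnson2P[//|A A2 ->] _|/perm_vecs_thirdsP[j ->] ij].
  exact: sqdist_thirds_indic.
by left; apply: sqdist_thirds; apply: contra ij => /eqP ->.
Qed.

(** Being the largest extension, and not only a maximal one, is what gives uniqueness. *)
Lemma johnson2_thirds_largest (B : {fset 'rV[R]_9}) :
  {subset B <= hyperplane R 9 2} -> distance_set 2 B -> johnson2 R 9 `<=` B ->
  B `<=` L.
Proof.
move=> BH B2 JB; apply/fsubsetP => x xB; rewrite inE.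
have [//|xJ] := boolP (x \in johnson2 R 9).
by have [//|_ ?] := two_distance_extension _ BH B2 JB xB xJ; apply/perm_vecs_thirdsP.
Qed.

Lemma johnson2_thirds_maximal : maximal_distance_set 2 (hyperplane R 9 2) L.
Proof.
split; [exact: johnson2_thirds_hyperplane|exact: johnson2_thirds_distance_set|].
move=> B BH B2 LB; apply/eqP; rewrite eqEfsubset LB andbT.
by apply: johnson2_thirds_largest => //; apply: fsubset_trans LB; apply: fsubsetUl.
Qed.

Lemma card_johnson2_thirds : #|` L| = 45%N.
Proof.
have TE : T = [fset thirds R i | i in 'I_9].
  apply/fsetP => x; apply/perm_vecs_thirdsP/imfsetP => [[i ->]|[i _ ->]];
    by exists i.
have cT : #|` T| = 9%N.
  by rewrite TE card_imfset /=; [rewrite -cardE card_ord|exact: thirds_inj].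
have JT0 : johnson2 R 9 `&` T = fset0.
  apply/fsetP => x; rewrite !inE; apply/negbTE/negP.
  case/andP=> /johnson2P[//|A _ ->] /perm_vecs_thirdsP[i /rowP/(_ i)].
  (* At [i] one vector has the entry [-2/3], the other 0 or 1. *)
  by rewrite !mxE eqxx; case: (i \in A) => /=; lra.
by rewrite cardfsU JT0 cardfs0 subn0 cT card_johnson2.
Qed.

End Nine.

Theorem mainTheorem2 (R : realType) (n : nat) (hn : (4 <= n)%N) :
  (n <> 9%N ->
     maximal_distance_set 2 (hyperplane R n 2) (johnson2 R n)) /\
  (n = 9%N ->
     let L : {fset 'rV[R]_n} :=
       perm_vecs n [:: (1, 2%N); (0, 7%N)] `|`
       perm_vecs n [:: (1 / 3%:R, 8%N); (- (2%:R / 3%:R), 1%N)] in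
     (forall A : {fset 'rV[R]_n},
        maximal_distance_set 2 (hyperplane R n 2) A /\ johnson2 R n `<=` A
        <-> A = L) /\
     #|` L| = 45%N).
Proof.
split; first exact: johnson2_maximal.
(* With [n = 9], [n - 2] computes to [7], so the first part of [L] is convertible to
   [johnson2 R 9]. *)
move=> n9; subst n => L; split; last exact: card_johnson2_thirds.
move=> A; split=> [[[AH A2 Amax] JA]|->].
  (* Maximality of [A] is applied to [L], which contains [A]. *)
  symmetry; apply: Amax; [exact: johnson2_thirds_hyperplane|exact: johnson2_thirds_distance_set|].
  exact: johnson2_thirds_largest.
by split; [exact: johnson2_thirds_maximal|exact: fsubsetUl].
Qed.
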